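(* Let $F\colon\mathbf{Set}\to\mathbf{Set}$ be a weak pullback preserving functor with a well-behaved evaluation function $ev_F$. The Wasserstein lifting of $F$ preserves isometries: if $f\colon(X,d_X)\to(Y,d_Y)$ satisfies $d_Y(f(x),f(x'))=d_X(x,x')$ for all $x,x'\in X$, then $W^F_{d_Y}(Ff(t_1),Ff(t_2))=W^F_{d_X}(t_1,t_2)$ for all $t_1,t_2\in FX$.
   Context: Fix $\top\in(0,\infty]$; pseudometrics take values in $[0,\top]$. $d_e$ is the Euclidean distance on $[0,\top]$ (with $d_e(a,\infty)=\infty$ for $a\ne\infty$, $d_e(\infty,\infty)=0$). An evaluation function for $F$ is $ev_F\colon F[0,\top]\to[0,\top]$; $\tilde Fg=ev_F\circ Fg$ for $g\colon X\to[0,\top]$. $ev_F$ is well-behaved if (W1) $f\le g$ implies $\tilde Ff\le\tilde Fg$; (W2) for every $t\in F([0,\top]^2)$, $d_e(ev_F(F\pi_1 t),ev_F(F\pi_2 t))\le\tilde Fd_e(t)$; (W3) $ev_F^{-1}[\{0\}]=Fi[F\{0\}]$, $i\colon\{0\}\hookrightarrow[0,\top]$. A coupling of $t_1,t_2\in FX$ is $t\in F(X\times X)$ with $F\pi_i(t)=t_i$; $W^F_d(t_1,t_2)=\inf\{\tilde Fd(t)\mid t\text{ coupling of }t_1,t_2\}$ ($\inf\emptyset=\top$). The Wasserstein lifting maps $(X,d)$ to $(FX,W^F_d)$ and $f$ to $Ff$. *)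

(* Defs.v *)
From HB Require Import structures.
From mathcomp Require Import all_boot all_order all_algebra.
From mathcomp Require Import all_classical all_reals ereal.

Set Implicit Arguments.
Unset Strict Implicit.
Unset Printing Implicit Defensive.
Import Order.TTheory GRing.Theory Num.Theory.

Local Open Scope classical_set_scope.
Local Open Scope ereal_scope.

(* The objects of the category Set.  Naming one copy of Type keeps all objects
   in a single universe, so that a [functor] below is an endofunctor. *)
Definition SET := Type.

Record functor := Functor {
  fobj :> SET -> SET ;
  fmor : forall A B : SET, (A -> B) -> fobj A -> fobj B ;
  fmor_id : forall A : SET, fmor (@idfun A) = idfun ;
  fmor_comp : forall (A B C : SET) (g : B -> C) (f : A -> B),
    fmor (g \o f) = fmor g \o fmor f }.

Arguments fmor F {A B} f : rename.

Definition is_weak_pullback (P A B C : SET)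
    (p1 : P -> A) (p2 : P -> B) (f : A -> C) (g : B -> C) : Prop :=
  f \o p1 = g \o p2 /\
  forall (Z : SET) (q1 : Z -> A) (q2 : Z -> B), f \o q1 = g \o q2 ->
    exists h : Z -> P, p1 \o h = q1 /\ p2 \o h = q2.

Definition preserves_weak_pullbacks (F : functor) : Prop :=
  forall (P A B C : SET)
    (p1 : P -> A) (p2 : P -> B) (f : A -> C) (g : B -> C),
  is_weak_pullback p1 p2 f g ->
  is_weak_pullback (fmor F p1) (fmor F p2) (fmor F f) (fmor F g).

(* The interval [0, top] of the extended reals; top may be +oo. *)
Definition dist (R : realType) (top : \bar R) : SET :=
  {x : \bar R | (0 <= x) && (x <= top)}.

Definition dist_val (R : realType) (top : \bar R) (a : dist top) : \bar R :=
  val a.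
Coercion dist_val : dist >-> extended.

(* The case split is needed because +oo - +oo = -oo in the library. *)
Definition euclid_val (R : realType) (a b : \bar R) : \bar R :=
  if a == b then 0 else `|a - b|.

Lemma euclid_subproof (R : realType) (top : \bar R) (a b : dist top) :
  (0 <= euclid_val a b) && (euclid_val a b <= top).
Proof.
have H (x y : R) : 0 <= x%:E -> 0 <= y%:E -> x%:E <= top -> y%:E <= top ->
    `|x%:E - y%:E| <= top.
  rewrite !lee_fin => x0 y0 xt yt; rewrite -EFinB abse_EFin.
  have [xy|/ltW yx] := leP x y.
    by apply: le_trans yt; rewrite lee_fin distrC ger0_norm ?subr_ge0 ?gerBl.
  by apply: le_trans xt; rewrite lee_fin ger0_norm ?subr_ge0 ?gerBl.
rewrite /dist_val; case: a b => [a /andP[a0 at_]] [b /andP[b0 bt]] /=.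
rewrite /euclid_val; case: ifPn => [_|ab]; first by rewrite lexx (le_trans a0).
rewrite abse_ge0 /=.
case: a b a0 at_ b0 bt ab => [a| |] [b| |] // a0 at_ b0 bt _.
exact: H.
Qed.

Definition euclid (R : realType) (top : \bar R) (a b : dist top) : dist top :=
  exist _ (euclid_val a b) (euclid_subproof a b).

Record pseudometric (R : realType) (top : \bar R) (X : SET) := Pseudometric {
  pdist :> X -> X -> dist top ;
  pdist_refl : forall x, pdist x x = 0 :> \bar R ;
  pdist_sym : forall x y, pdist x y = pdist y x ;
  pdist_triangle : forall x y z,
    (pdist x z : \bar R) <= (pdist x y : \bar R) + (pdist y z : \bar R) }.

Definition ev_lift (R : realType) (top : \bar R) (F : functor)
    (ev : F (dist top) -> dist top) (X : SET) (g : X -> dist top) :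
    F X -> dist top :=
  ev \o fmor F g.

Record well_behaved (R : realType) (top : \bar R) (F : functor)
    (ev : F (dist top) -> dist top) : Prop := WellBehaved {
  wb_monotone : forall (X : SET) (f g : X -> dist top),
    (forall x, (f x : \bar R) <= (g x : \bar R)) ->
    forall t : F X, (ev_lift ev f t : \bar R) <= (ev_lift ev g t : \bar R) ;
  wb_euclid : forall t : F (dist top * dist top)%type,
    (euclid (ev (fmor F fst t)) (ev (fmor F snd t)) : \bar R)
      <= (ev_lift ev (uncurry (@euclid R top)) t : \bar R) ;
  wb_zero :
    [set t | ev t = 0 :> \bar R] =
    range (fmor F (val : {a : dist top | (a : \bar R) == 0} -> dist top)) }.

Definition coupling (F : functor) (X : SET) (t1 t2 : F X) : set (F (X * X)%type) :=
  [set t | fmor F fst t = t1 /\ fmor F snd t = t2].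

(* Taking the minimum with top yields the infimum computed in [0, top], which
   is top when there is no coupling (in the extended reals it is +oo). *)
Definition wasserstein_val (R : realType) (top : \bar R) (F : functor)
    (ev : F (dist top) -> dist top) (X : SET) (d : X -> X -> dist top)
    (t1 t2 : F X) : \bar R :=
  Order.min top
    (ereal_inf [set (ev_lift ev (uncurry d) t : \bar R) | t in coupling t1 t2]).

Lemma wasserstein_subproof (R : realType) (top : \bar R) (top_gt0 : 0 < top)
    (F : functor) (ev : F (dist top) -> dist top) (X : SET)
    (d : X -> X -> dist top) (t1 t2 : F X) :
  (0 <= wasserstein_val ev d t1 t2) && (wasserstein_val ev d t1 t2 <= top).
Proof.
rewrite /wasserstein_val le_min (ltW top_gt0) ge_min lexx andbT /=.
apply: le_ereal_inf_tmp => _ [t _ <-].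
by rewrite /dist_val; case: (ev_lift _ _ _) => x /= /andP[].
Qed.

Definition wasserstein (R : realType) (top : \bar R) (top_gt0 : 0 < top)
    (F : functor) (ev : F (dist top) -> dist top) (X : SET)
    (d : X -> X -> dist top) (t1 t2 : F X) : dist top :=
  exist _ (wasserstein_val ev d t1 t2)
    (wasserstein_subproof top_gt0 ev d t1 t2).

Definition is_isometry (R : realType) (top : \bar R) (X Y : SET)
    (dX : X -> X -> dist top) (dY : Y -> Y -> dist top) (f : X -> Y) : Prop :=
  forall x x' : X, dY (f x) (f x') = dX x x'.

(* Main.v *)
(* For any f : X -> Y, a coupling of Ff t1 and Ff t2 is the image under F(f x f)
   of a coupling of t1 and t2: pull it back one coordinate at a time along the
   pullback squares formed by f and a product projection. If f is an isometry
   then dY o (f x f) = dX, so t1, t2 and their images have couplings with the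
   same sets of values. *)
Require Import Defs.
From mathcomp Require Import all_boot all_order all_algebra.
From mathcomp Require Import all_classical all_reals ereal.
Import Order.TTheory GRing.Theory Num.Theory.

Lemma fmor_compE (F : functor) (A B C : SET) (g : B -> C) (f : A -> B)
  (t : F A) : fmor F g (fmor F f t) = fmor F (g \o f) t.
Proof. by rewrite fmor_comp. Qed.

(** Elements are maps out of [unit], so the weak universal property is applied there. *)
Lemma weak_pullback_elt (P A B C : SET) (p1 : P -> A) (p2 : P -> B)
  (f : A -> C) (g : B -> C) (a : A) (b : B) :
  is_weak_pullback p1 p2 f g -> f a = g b ->
  exists p : P, p1 p = a /\ p2 p = b.
Proof.
move=> [_ wp] fab.
have [|h [h1 h2]] := wp unit (fun=> a) (fun=> b); first exact/funext.
by exists (h tt); rewrite -[p1 _]/((p1 \o h) tt) h1 -[p2 _]/((p2 \o h) tt) h2.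
Qed.

Arguments weak_pullback_elt {P A B C p1 p2 f g a b}.

Lemma weak_pullback_fst (X Y Z : SET) (f : X -> Y) :
  is_weak_pullback fst (fun p : X * Z => (f p.1, p.2)) f fst.
Proof.
split=> // W q1 q2 q12; exists (fun w => (q1 w, (q2 w).2)); split=> //.
by apply/funext => w /=; rewrite -[f _]/((f \o q1) w) q12 /= -surjective_pairing.
Qed.

Lemma weak_pullback_snd (X Y Z : SET) (f : X -> Y) :
  is_weak_pullback snd (fun p : Z * X => (p.1, f p.2)) f snd.
Proof.
split=> // W q1 q2 q12; exists (fun w => ((q2 w).1, q1 w)); split=> //.
by apply/funext => w /=; rewrite -[f _]/((f \o q1) w) q12 /= -surjective_pairing.
Qed.

Lemma coupling_fmor (F : functor) (wpbF : preserves_weak_pullbacks F)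
  (X Y : SET) (f : X -> Y) (t1 t2 : F X) :
  coupling (fmor F f t1) (fmor F f t2) =
  [set fmor F (fun p : X * X => (f p.1, f p.2)) t | t in coupling t1 t2]%classic.
Proof.
apply/seteqP; split=> [t [t_1 t_2]|_ [t [<- <-] <-]]; last first.
  by split; rewrite !fmor_compE.
(* [s] in [F (X * Y)] lifts [t] along [f] in the first coordinate; its first marginal is [t1]. *)
have [s [s_1 s_t]] := weak_pullback_elt
  (wpbF _ _ _ _ _ _ _ _ (@weak_pullback_fst X Y Y f)) (esym t_1).
have s_2 : fmor F f t2 = fmor F snd s by rewrite -t_2 -s_t fmor_compE.
(* The second coordinate of [s] is lifted likewise, giving [u] in [F (X * X)] with second marginal
   [t2]. *)
have [u [u_2 u_s]] := weak_pullback_elt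
  (wpbF _ _ _ _ _ _ _ _ (@weak_pullback_snd X Y X f)) s_2.
exists u; first by split=> //; rewrite -s_1 -u_s fmor_compE.
by rewrite -s_t -u_s fmor_compE.
Qed.

Theorem theorem5p23 (R : realType) (top : \bar R) (top_gt0 : (0 < top)%E)
  (F : functor) (wpbF : preserves_weak_pullbacks F)
  (ev : F (dist top) -> dist top) (wbev : well_behaved ev)
  (X Y : SET) (dX : pseudometric top X) (dY : pseudometric top Y)
  (f : X -> Y) (isof : is_isometry dX dY f) (t1 t2 : F X) :
  wasserstein top_gt0 ev dY (fmor F f t1) (fmor F f t2) =
  wasserstein top_gt0 ev dX t1 t2.
Proof.
(* Both infima now range over the couplings of [t1] and [t2], so it suffices to compare values
   coupling by coupling. *)
apply: val_inj; rewrite /= /wasserstein_val coupling_fmor // image_comp.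
congr (Order.min top (ereal_inf _)); apply: eq_imagel => t _ /=.
rewrite /ev_lift /= fmor_compE.
by congr (dist_val (ev (fmor F _ t))); apply/funext => -[x x'] /=; exact: isof.
Qed.
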